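(* Let $k>0$, let $M=\mathbb{R}^n$ with the Euclidean metric, let $U_1(x)=-\frac k2|x|^2$, $U_2\equiv0$, and let $$p_t(0,x):=\rho_t(x)=\left(\frac{2\pi(\exp(2tk)-1)}{k\exp(2tk)}\right)^{-n/2}\exp\left(\frac{-k|x|^2}{2(\exp(2tk)-1)}\right).$$ Then for all $t>0$ and $x\in\mathbb{R}^n$, $$p_t(0,x)=\exp\left(-\tfrac12\big(c_{0,t}(0,x)+U_1(x)-U_1(0)\big)\right)\left(4\pi\,b_{-k^2}(t)\right)^{-\frac n2},$$ where $b_{-k^2}(t)=\frac1k\sinh(kt)$, $$c_{0,t}(0,x)=\inf_{\gamma(0)=0,\ \gamma(t)=x}\int_0^t\Big(\tfrac12|\dot\gamma(\tau)|^2+V(\gamma(\tau))\Big)d\tau ,$$ the infimum being over all paths $\gamma:[0,t]\to\mathbb{R}^n$ from $0$ to $x$, and $$V=\Delta U_1+\tfrac12|\nabla U_1|^2-2U_2=-kn+\tfrac12k^2|x|^2 .$$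
   Context: The function $\rho_t$ is a solution of $\dot\rho_t=\Delta\rho_t-k\langle x,\nabla\rho_t\rangle$ on $\mathbb{R}^n$. Paths are taken, say, piecewise smooth. *)

(* Defs.v *)
From HB Require Import structures.
From mathcomp Require Import all_boot all_order all_algebra.
From mathcomp Require Import all_classical all_reals all_analysis.

Set Implicit Arguments.
Unset Strict Implicit.
Unset Printing Implicit Defensive.

Import Order.TTheory GRing.Theory Num.Theory.
Import numFieldNormedType.Exports.

Local Open Scope classical_set_scope.
Local Open Scope ring_scope.

Definition sinh {R : realType} (u : R) : R := (expR u - expR (- u)) / 2.

(* The library norm on ['rV[R]_n] is the sup norm, which only provides the
   topology here. This is the square of the Euclidean norm. *)
Definition sqnorm {R : realType} {n : nat} (x : 'rV[R]_n) : R :=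
  \sum_(i < n) x 0 i ^+ 2.

Definition grad {R : realType} {n : nat} (f : 'rV[R]_n -> R) (x : 'rV[R]_n) :
    'rV[R]_n :=
  \row_(i < n) 'D_(delta_mx 0 i) f x.

Definition laplacian {R : realType} {n : nat} (f : 'rV[R]_n -> R)
    (x : 'rV[R]_n) : R :=
  \sum_(i < n) 'D_(delta_mx 0 i) (fun y => 'D_(delta_mx 0 i) f y) x.

Definition smooth {R : realType} {n : nat} (g : R -> 'rV[R]_n) : Prop :=
  forall (m : nat) (u : R), derivable (g^`(m))%classic u 1.

(* A curve is smooth on a closed interval when it is there the restriction of
   a smooth curve on the line. Consecutive pieces share their common endpoint,
   so a piecewise smooth curve is continuous on [`[a, b]]. Values of [gamma]
   outside [`[a, b]] are irrelevant. *)
Definition piecewise_smooth {R : realType} {n : nat} (a b : R)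
    (gamma : R -> 'rV[R]_n) : Prop :=
  exists2 s : seq R, itv_partition a b s &
    forall i : nat, (i < size s)%N ->
      exists2 g : R -> 'rV[R]_n, smooth g &
        {in `[nth b (a :: s) i, nth b s i], gamma =1 g}.

Definition paths {R : realType} {n : nat} (a b : R) (x y : 'rV[R]_n) :
    set (R -> 'rV[R]_n) :=
  [set gamma | [/\ piecewise_smooth a b gamma, gamma a = x & gamma b = y]].

(* At the finitely many points where [gamma] may fail to be differentiable,
   [gamma^`()] has an arbitrary value, which does not affect the integral. *)
Definition action {R : realType} {n : nat} (V : 'rV[R]_n -> R) (a b : R)
    (gamma : R -> 'rV[R]_n) : \bar R :=
  (\int[lebesgue_measure]_(u in `[a, b])
     (2^-1 * sqnorm (gamma^`()%classic u) + V (gamma u))%:E)%E.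

Definition cost {R : realType} {n : nat} (V : 'rV[R]_n -> R) (a b : R)
    (x y : 'rV[R]_n) : \bar R :=
  ereal_inf [set action V a b gamma | gamma in paths a b x y].

Definition rho {R : realType} {n : nat} (k t : R) (x : 'rV[R]_n) : R :=
  ((2 * pi * (expR (2 * t * k) - 1)) / (k * expR (2 * t * k)))
    `^ (- (n%:R / 2))
  * expR ((- k * sqnorm x) / (2 * (expR (2 * t * k) - 1))).

(* [b_neg k] is the function b_K for the negative curvature K = - k ^ 2. *)
Definition b_neg {R : realType} (k t : R) : R := k^-1 * sinh (k * t).

(* Main.v *)
(* Up to an additive constant, the cost is the minimal action of an inverted
   harmonic oscillator, attained by the curve u |-> sinh(ku)/sinh(kt) x.
   Minimality follows from a calibration S: along every smooth curve g the
   Lagrangian is at least d/du S(u, g(u)), with equality for the minimiser.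
   Adding up over the pieces, the action of a piecewise smooth curve is at least
   the increment of S, which only depends on the end points. Here S is affine in
   the position: it comes from linearising the convex Lagrangian at the minimiser. *)
Require Import Defs.
From HB Require Import structures.
From mathcomp Require Import all_boot all_order all_algebra.
From mathcomp Require Import all_classical all_reals all_analysis.
From mathcomp Require Import measurable_realfun ring.

Import Order.TTheory GRing.Theory Num.Theory.
Import numFieldNormedType.Exports.

Local Open Scope classical_set_scope.
Local Open Scope ring_scope.

(** * Differential calculus of the Euclidean square norm *)

Section QuadraticForm.
Context {R : realType} {n : nat}.

Lemma is_derive_coord (i : 'I_n) (y v : 'rV[R]_n) :
  is_derive y v (fun z : 'rV[R]_n => z 0 i) (v 0 i).
Proof.
apply: DeriveDef; first exact/diff_derivable/differentiable_coord.
have := derive_mx (@derivable_id R 'rV[R]_n y v).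
by rewrite derive_id => /matrixP/(_ 0 i); rewrite mxE.
Qed.

Lemma sqnormE : sqnorm = \sum_(i < n) ((fun y : 'rV[R]_n => y 0 i) ^+ 2).
Proof. by apply/funext => y; rewrite fct_sumE; apply: eq_bigr => i _. Qed.

Lemma continuous_sqnorm : continuous (@sqnorm R n).
Proof.
move=> y; rewrite sqnormE; apply: differentiable_continuous.
apply: differentiable_sum => i; apply: differentiableX.
exact: differentiable_coord.
Qed.

Lemma derive_sqnorm (c : R) (i : 'I_n) (y : 'rV[R]_n) :
  'D_(delta_mx 0 i) (fun z => c * sqnorm z) y = c * (2 * y 0 i).
Proof.
have -> : (fun z => c * sqnorm z) = c *: @sqnorm R n by [].
rewrite sqnormE; apply: derive_val.
apply: is_derive_eq; first apply: is_deriveZ.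
  apply: is_derive_sum => j; apply: is_deriveX; exact: is_derive_coord.
congr (c * _); rewrite (bigD1 i)//= big1 ?addr0 => [|j ji]; rewrite mxE eqxx/=.
  by rewrite eqxx /= expr1; exact: mulr1.
by rewrite (negbTE ji) scaler0.
Qed.

Lemma grad_sqnorm (c : R) (y : 'rV[R]_n) :
  grad (fun z => c * sqnorm z) y = (2 * c) *: y.
Proof. by apply/rowP => i; rewrite !mxE derive_sqnorm mulrCA mulrA. Qed.

Lemma laplacian_sqnorm (c : R) (y : 'rV[R]_n) :
  laplacian (fun z => c * sqnorm z) y = 2 * c * n%:R.
Proof.
rewrite /laplacian -[n in RHS]card_ord mulr_natr -sumr_const.
apply: eq_bigr => i _; under eq_fun do rewrite derive_sqnorm mulrA.
have /@derive_val := is_deriveZ (c * 2) (is_derive_coord i y (delta_mx 0 i)).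
by rewrite mxE !eqxx => h; rewrite [RHS]mulrC -[RHS]mulr1; exact: h.
Qed.

Lemma sqnorm_ge0 (y : 'rV[R]_n) : 0 <= sqnorm y.
Proof. by apply: sumr_ge0 => i _; exact: sqr_ge0. Qed.

Lemma sqnormZ (c : R) (y : 'rV[R]_n) : sqnorm (c *: y) = c ^+ 2 * sqnorm y.
Proof.
by rewrite /sqnorm mulr_sumr; apply: eq_bigr => i _; rewrite mxE exprMn.
Qed.

Lemma sqnorm0 : sqnorm (0 : 'rV[R]_n) = 0.
Proof. by rewrite -(scale0r (0 : 'rV[R]_n)) sqnormZ expr0n mul0r. Qed.

End QuadraticForm.

(** * The Lagrangian along smooth curves *)

Section Action.
Context {R : realType} {n : nat}.
Notation mu := (@lebesgue_measure R).

Lemma integral_derive (F f : R -> R) (a b : R) : a < b ->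
  continuous f -> (forall u : R, is_derive u 1 F (f u)) ->
  (\int[mu]_(u in `[a, b]) (f u)%:E)%E = (F b - F a)%:E.
Proof.
move=> ab cf dF.
have cF : continuous F.
  by move=> u; apply/differentiable_continuous/derivable1_diffP; exact: ex_derive.
rewrite (@continuous_FTC2 _ f F)//.
- exact: continuous_subspaceT.
- split; first by move=> u _; exact: ex_derive.
  + by apply: cvg_at_right_filter; exact: cF.
  + by apply: cvg_at_left_filter; exact: cF.
- by move=> u _; rewrite derive1E derive_val.
Qed.

Lemma smooth_is_derive (g : R -> 'rV[R]_n) i (u : R) : smooth g ->
  is_derive u 1 (fun v => g v 0 i) (g^`()%classic u 0 i).
Proof.
move=> sg; have dg : derivable g u 1 := sg 0%N u.
apply: DeriveDef; first exact: (derivable_mxP g u 1).1.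
by rewrite derive1E derive_mx// mxE.
Qed.

Lemma smooth_continuous (g : R -> 'rV[R]_n) : smooth g -> continuous g.
Proof.
by move=> sg u; apply/differentiable_continuous/derivable1_diffP/(sg 0%N).
Qed.

Lemma smooth_derive1_continuous (g : R -> 'rV[R]_n) :
  smooth g -> continuous (g^`())%classic.
Proof.
by move=> sg u; apply/differentiable_continuous/derivable1_diffP/(sg 1%N).
Qed.

Definition lagrangian (V : 'rV[R]_n -> R) (g : R -> 'rV[R]_n) (u : R) : R :=
  2^-1 * sqnorm (g^`()%classic u) + V (g u).

Lemma lagrangian_continuous V g : continuous V -> smooth g ->
  continuous (lagrangian V g).
Proof.
move=> cV sg u; apply: cvgD; first apply: cvgM; first exact: cvg_cst.
  apply: (@continuous_comp _ _ _ (g^`())%classic sqnorm).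
    exact: smooth_derive1_continuous.
  exact: continuous_sqnorm.
by apply: (continuous_comp _ _); [exact: smooth_continuous|exact: cV].
Qed.

(** The interval becomes open because a derivative at an endpoint also depends on the values of the
    curve outside [[a, b]]. *)
Lemma lagrangian_eq_in V {g h : R -> 'rV[R]_n} {a b} :
  {in `[a, b], g =1 h} -> {in `]a, b[, lagrangian V g =1 lagrangian V h}.
Proof.
move=> gh u uab; rewrite /lagrangian gh; last exact: subset_itv_oo_cc.
congr (2^-1 * sqnorm _ + _); rewrite !derive1E; apply: near_eq_derive => //.
have : \forall v \near u, v \in `]a, b[ by exact: near_in_itvoo.
by apply: filterS => v vab; rewrite gh//; exact: subset_itv_oo_cc.
Qed.

End Action.

(** * From smooth calibration to a lower bound on the cost *)

Section Calibration.
Context {R : realType} {n : nat}.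
Variables (V : 'rV[R]_n -> R) (S : R -> 'rV[R]_n -> R).
Hypothesis cV : continuous V.
Hypothesis calV : forall (g : R -> 'rV[R]_n) (c d : R), smooth g -> c < d ->
  ((S d (g d) - S c (g c))%:E <= action V c d g)%E.

Lemma measurable_lagrangian_piece {gamma g : R -> 'rV[R]_n} {c d : R} :
  smooth g -> {in `[c, d], gamma =1 g} ->
  measurable_fun `[c, d] (lagrangian V gamma).
Proof.
(* Measurability on the open interval suffices: the two endpoints, where [gamma] may have no
   derivative, are harmless. *)
move=> sg gg; apply: (@measurable_fun_itv_cc _ _ _ false true).
apply: (@eq_measurable_fun _ _ _ _ _ (lagrangian V g)).
  by move=> u; rewrite inE/= => ucd; apply/esym; exact: (lagrangian_eq_in V gg).
apply: measurable_funTS; apply: continuous_measurable_fun.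
exact: lagrangian_continuous.
Qed.

Lemma action_piece {gamma g : R -> 'rV[R]_n} {c d : R} :
  smooth g -> {in `[c, d], gamma =1 g} -> action V c d gamma = action V c d g.
Proof.
move=> sg gg; rewrite /action.
apply: (@eq_integral_itv_bounded _ _ _ (lagrangian V g) (lagrangian V gamma)).
- apply: measurable_funS (measurable_lagrangian_piece sg gg) => //.
  exact: subset_itv_oo_cc.
- apply: measurable_funTS; apply: continuous_measurable_fun.
  exact: lagrangian_continuous.
- exact: lagrangian_eq_in.
Qed.

(** Induction on the partition, peeling off the first piece. Measurability of the Lagrangian is
    carried along because splitting the integral at a break point requires it. *)
Lemma calibration_pieces (gamma : R -> 'rV[R]_n) (b : R) (s : seq R) (a : R) :
  itv_partition a b s ->
  (forall i : nat, (i < size s)%N ->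
    exists2 g : R -> 'rV[R]_n, smooth g &
      {in `[nth b (a :: s) i, nth b s i], gamma =1 g}) ->
  measurable_fun `[a, b] (lagrangian V gamma) /\
  ((S b (gamma b) - S a (gamma a))%:E <= action V a b gamma)%E.
Proof.
elim: s a => [|c s IHs] a.
  (* An empty partition forces [a = b], so the increment and the action are both zero. *)
  move=> /itv_partition_nil -> _; rewrite /action set_itv1 integral_set1 subrr.
  by split => //; exact: measurable_fun_set1.
move=> abs pieces; have cbs := itv_partition_cons abs.
have ac : a < c by case: abs => /= /andP[].
have cb : c <= b := itv_partition_le cbs.
have [mcb Scb] := IHs c cbs (fun i => pieces i.+1).
have [g sg gg] := pieces 0%N isT; rewrite /= in gg.
have mac := measurable_lagrangian_piece sg gg.
have abE : `[a, b]%classic = `[a, c] `|` `]c, b].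
  by rewrite -itv_bndbnd_setU// bnd_simp ltW.
have mab : measurable_fun `[a, b] (lagrangian V gamma).
  rewrite abE; apply/measurable_funU => //; split => //.
  by apply: measurable_funS mcb => //; exact: subset_itv_oc_cc.
split => //; rewrite /action abE integral_setU//=; last 2 first.
- by rewrite -abE; exact/measurable_EFinP.
- rewrite disj_set2E; apply/eqP; rewrite -subset0 => u [] /=.
  by rewrite !in_itv/= => /andP[_ uc] /andP[]; rewrite ltNge uc.
rewrite integral_itv_obnd_cbnd; last first.
  apply/measurable_EFinP; apply: measurable_funS mcb => //.
  exact: subset_itv_oc_cc.
rewrite -!/(action V _ _ gamma) (action_piece sg gg).
(* The increments of [S] telescope at [c]: the smooth calibration bounds the first, the induction
   hypothesis the second. *)
have -> : S b (gamma b) - S a (gamma a) =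
    S c (gamma c) - S a (gamma a) + (S b (gamma b) - S c (gamma c)) by ring.
rewrite EFinD leeD// (gg a) ?(gg c) ?in_itv/= ?lexx ?(ltW ac)//.
exact: calV.
Qed.

Lemma calibration_le_cost (a b : R) (x y : 'rV[R]_n) :
  ((S b y - S a x)%:E <= cost V a b x y)%E.
Proof.
apply: le_ereal_inf_tmp => _ [gamma [[s abs pieces] <- <-] <-].
by have [] := calibration_pieces _ _ _ _ abs pieces.
Qed.

End Calibration.

(** * Hyperbolic functions and smoothness of the minimiser *)

Section Hyperbolic.
Context {R : realType}.
Implicit Types k u : R.

Definition cosh (u : R) : R := (expR u + expR (- u)) / 2.

Lemma sinh0 : sinh 0 = 0 :> R.
Proof. by rewrite /sinh oppr0 subrr mul0r. Qed.

Lemma sinh_gt0 u : 0 < u -> 0 < sinh u.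
Proof. by move=> u0; rewrite divr_gt0// subr_gt0 ltr_expR gtrN. Qed.

Lemma is_derive_expRM k u :
  is_derive u 1 (fun v => expR (k * v)) (k * expR (k * u)).
Proof.
have -> : (fun v => expR (k * v)) = expR \o (k *: id) by [].
apply: is_derive_eq.
by rewrite mulrC; congr (_ * _); exact: mulr1.
Qed.

Lemma is_derive_sinh k c u :
  is_derive u 1 (fun v => c * sinh (k * v)) (c * k * cosh (k * u)).
Proof.
have -> : (fun v => c * sinh (k * v)) =
    (c / 2) *: ((fun v => expR (k * v)) - (fun v => expR (- k * v))).
  apply/funext => v; rewrite -[RHS]/(_ * (_ - expR (- k * v))) /sinh mulNr.
  by ring.
have ? := is_derive_expRM k u; have ? := is_derive_expRM (- k) u.
apply: is_derive_eq; rewrite /cosh !mulNr -[LHS]/(_ * _).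
by ring.
Qed.

Lemma is_derive_cosh k c u :
  is_derive u 1 (fun v => c * cosh (k * v)) (c * k * sinh (k * u)).
Proof.
have -> : (fun v => c * cosh (k * v)) =
    (c / 2) *: ((fun v => expR (k * v)) + (fun v => expR (- k * v))).
  apply/funext => v; rewrite -[RHS]/(_ * (_ + expR (- k * v))) /cosh mulNr.
  by ring.
have ? := is_derive_expRM k u; have ? := is_derive_expRM (- k) u.
apply: is_derive_eq; rewrite /sinh !mulNr -[LHS]/(_ * _).
by ring.
Qed.

Lemma is_derive_scalel {n} (x : 'rV[R]_n) (f : R -> R) (df u : R) :
  is_derive u 1 f df -> is_derive u 1 (fun v => f v *: x) (df *: x).
Proof.
move=> [dfu dfE]; have dx : derivable (fun v => f v *: x) u 1.
  apply/derivable_mxP => i j.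
  have -> : (fun v => (f v *: x) i j) = f * cst (x i j).
    by apply/funext => v; rewrite mxE.
  exact: derivableM.
apply: DeriveDef => //; rewrite derive_mx//; apply/matrixP => i j; rewrite !mxE.
have -> : (fun v => (f v *: x) i j) = f * cst (x i j).
  by apply/funext => v; rewrite mxE.
by rewrite deriveM// derive_cst scaler0 add0r dfE; exact: mulrC.
Qed.

(** Smoothness asks for derivability of every iterated derivative, so a closed form for all orders
    is established first. *)
Lemma derive1n_sinh {n} k c (x : 'rV[R]_n) m :
  (fun u => (c * sinh (k * u)) *: x)^`(m)%classic =
  (fun u => (c * k ^+ m * (if odd m then cosh (k * u) else sinh (k * u))) *: x).
Proof.
elim: m => [|m IHm]; first by rewrite derive1n0 expr0 mulr1.
rewrite derive1nS IHm; apply/funext => u /=; rewrite derive1E.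
apply: derive_val; apply: is_derive_scalel; rewrite exprSr mulrA.
by case: (odd m); [exact: is_derive_cosh | exact: is_derive_sinh].
Qed.

Lemma smooth_sinh {n} k c (x : 'rV[R]_n) :
  smooth (fun u => (c * sinh (k * u)) *: x).
Proof.
move=> m u; rewrite derive1n_sinh.
have [|] := boolP (odd m) => _.
  by have [] := is_derive_scalel x _ _ _ (is_derive_cosh k (c * k ^+ m) u).
by have [] := is_derive_scalel x _ _ _ (is_derive_sinh k (c * k ^+ m) u).
Qed.

End Hyperbolic.

(** * Cost of the inverted harmonic oscillator *)

Section OscillatorCost.
Context {R : realType} {n : nat}.
Variables (k C t : R) (x : 'rV[R]_n).
Hypotheses (k_gt0 : 0 < k) (t_gt0 : 0 < t).

Let V (y : 'rV[R]_n) : R := C + 2^-1 * k ^+ 2 * sqnorm y.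
(** Scalar profile of the minimiser: the solution of the Euler-Lagrange equation [f'' = k ^+ 2 * f]
    with value 0 at time 0 and 1 at time [t]. *)
Let f (u : R) : R := (sinh (k * t))^-1 * sinh (k * u).
Let f' (u : R) : R := (sinh (k * t))^-1 * k * cosh (k * u).
(* [S] is regular at time 0, unlike the usual calibration by Hamilton's principal
   function k/2 coth(ku) |y|^2. *)
Let S (u : R) (y : 'rV[R]_n) : R :=
  f' u * (\sum_(i < n) x 0 i * y 0 i) - 2^-1 * (f u * f' u) * sqnorm x + C * u.

Let is_derive_f (u : R) : is_derive u 1 f (f' u).
Proof. exact: is_derive_sinh. Qed.

Let is_derive_f' (u : R) : is_derive u 1 f' (k ^+ 2 * f u).
Proof.
have -> : k ^+ 2 * f u = (sinh (k * t))^-1 * k * k * sinh (k * u).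
  by rewrite /f; ring.
exact: is_derive_cosh.
Qed.

Let continuous_V : continuous V.
Proof.
move=> y; apply: (@continuous_comp _ _ _ sqnorm (fun r => C + 2^-1 * k ^+ 2 * r)).
  exact: continuous_sqnorm.
by apply: cvgD; [exact: cvg_cst|apply: cvgM; [exact: cvg_cst|exact: cvg_id]].
Qed.

(* The gap in the two inequalities |v|^2 / 2 >= <v, p> - |p|^2 / 2, one for the
   velocity and one for the position, that calibrate the Lagrangian. *)
Let defect (g : R -> 'rV[R]_n) (u : R) : R :=
  2^-1 * (sqnorm (g^`()%classic u - f' u *: x) +
          k ^+ 2 * sqnorm (g u - f u *: x)).

(** Since [f'' = k ^+ 2 * f], differentiating the term of [S] linear in the position yields the
    cross terms of the two squares in [defect]. The derivative of [f * f'] is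
    [f' ^+ 2 + k ^+ 2 * f ^+ 2], which accounts for their terms in [sqnorm x], and [C * u] accounts
    for the constant of [V]. *)
Let is_derive_S (g : R -> 'rV[R]_n) (u : R) : smooth g ->
  is_derive u 1 (fun v => S v (g v)) (lagrangian V g u - defect g u).
Proof.
move=> sg; pose G := \sum_(i < n) (x 0 i *: fun v => g v 0 i).
have SE : (fun v => S v (g v)) =
    f' * G - (2^-1 * sqnorm x) *: (f * f') + C *: id.
  apply/funext => v; rewrite /S.
  rewrite -[RHS]/(f' v * G v - 2^-1 * sqnorm x * (f v * f' v) + C * v).
  by rewrite /G fct_sumE; congr (_ * _ - _ + _); ring.
have dG : is_derive u 1 G (\sum_(i < n) x 0 i * g^`()%classic u 0 i).
  by apply: is_derive_sum => i; apply: is_deriveZ; exact: smooth_is_derive.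
have df := is_derive_f u; have df' := is_derive_f' u.
rewrite SE; apply: is_derive_eq.
set Gd := \sum_(i < n) _ in dG *.
have sqB (a : R) (y : 'rV[R]_n) : sqnorm (y - a *: x) =
    sqnorm y - 2 * a * (\sum_(i < n) x 0 i * y 0 i) + a ^+ 2 * sqnorm x.
  rewrite /sqnorm !mulr_sumr -sumrB -big_split/=.
  by apply: eq_bigr => i _; rewrite !mxE; ring.
rewrite -[LHS]/(f' u * Gd + G u * (k ^+ 2 * f u) -
  2^-1 * sqnorm x * (f u * (k ^+ 2 * f u) + f' u * f' u) + C * 1).
have -> : G u = \sum_(i < n) x 0 i * g u 0 i by rewrite /G fct_sumE.
rewrite /defect !sqB /lagrangian /V -/Gd.
by field.
Qed.

Let defect_ge0 g u : 0 <= defect g u.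
Proof.
apply: mulr_ge0; first by rewrite invr_ge0.
by apply: addr_ge0; [|apply: mulr_ge0; first exact: sqr_ge0]; exact: sqnorm_ge0.
Qed.

Let continuous_defect g : smooth g -> continuous (defect g).
Proof.
move=> sg u; apply: cvgM; [exact: cvg_cst|apply: cvgD].
  apply: (@continuous_comp _ _ _ (fun v => g^`()%classic v - f' v *: x) sqnorm).
    apply: cvgB; first exact: smooth_derive1_continuous.
    apply: cvgZ; last exact: cvg_cst.
    apply: differentiable_continuous.
    by apply/derivable1_diffP; exact: ex_derive.
  exact: continuous_sqnorm.
apply: cvgM; first exact: cvg_cst.
apply: (@continuous_comp _ _ _ (fun v => g v - f v *: x) sqnorm).
  apply: cvgB; first exact: smooth_continuous.
  apply: cvgZ; last exact: cvg_cst.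
    apply: differentiable_continuous.
  by apply/derivable1_diffP; exact: ex_derive.
exact: continuous_sqnorm.
Qed.

Let integral_calibration g c d : smooth g -> c < d ->
  (\int[lebesgue_measure]_(u in `[c, d]) (lagrangian V g u - defect g u)%:E)%E
    = (S d (g d) - S c (g c))%:E.
Proof.
move=> sg cd.
have cL : continuous (fun u => lagrangian V g u - defect g u).
  move=> u; apply: cvgB; first exact: lagrangian_continuous.
  exact: continuous_defect.
exact: (integral_derive _ _ _ _ cd cL (fun u => is_derive_S g u sg)).
Qed.

(** The integrand of the increment of [S] is the Lagrangian minus a nonnegative defect; both are
    continuous, hence integrable on a segment. *)
Let calibration g c d : smooth g -> c < d ->
  ((S d (g d) - S c (g c))%:E <= action V c d g)%E.
Proof.
move=> sg cd; rewrite -integral_calibration//; apply: le_integral => //.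
- apply: continuous_compact_integrable; first exact: segment_compact.
  apply: continuous_subspaceT => u.
  by apply: cvgB; [exact: lagrangian_continuous|exact: continuous_defect].
- apply: continuous_compact_integrable; first exact: segment_compact.
  by apply: continuous_subspaceT; exact: lagrangian_continuous.
- by move=> u _; rewrite lee_fin gerBl.
Qed.

Let smooth_extremal : smooth (fun u => f u *: x).
Proof. exact: smooth_sinh. Qed.

(** Both squares in the defect vanish along this curve, so calibration is an equality. *)
Let action_extremal :
  action V 0 t (fun u => f u *: x) = (S t (f t *: x) - S 0 (f 0 *: x))%:E.
Proof.
rewrite -(integral_calibration (fun u => f u *: x))//.
apply: eq_integral => u _; congr EFin.
have /@derive_val xE := is_derive_scalel x _ _ _ (is_derive_f u).
rewrite /defect subrr derive1E xE subrr sqnorm0 mulr0 addr0 mulr0 subr0. 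
by rewrite /lagrangian derive1E xE.
Qed.

Lemma oscillator_cost :
  cost (fun y : 'rV[R]_n => C + 2^-1 * k ^+ 2 * sqnorm y) 0 t 0 x =
  (2^-1 * k * (cosh (k * t) / sinh (k * t)) * sqnorm x + C * t)%:E.
Proof.
have f0 : f 0 = 0 by rewrite /f mulr0 sinh0 mulr0.
have ft : f t = 1 by rewrite /f mulVf// gt_eqF// sinh_gt0// mulr_gt0.
(* As [f t = 1], the two spatial terms of [S t x] combine to half of [f' t * sqnorm x], where [f' t]
   is k coth(kt). At time 0 and position 0 every term vanishes. *)
have -> : 2^-1 * k * (cosh (k * t) / sinh (k * t)) * sqnorm x + C * t =
    S t x - S 0 0.
  have x0E : \sum_(i < n) x 0 i * (0 : 'rV[R]_n) 0 i = 0.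
    by apply: big1 => i _; rewrite mxE mulr0.
  rewrite /S ft f0 x0E -[\sum_(i < n) _]/(sqnorm x) /f'.
  by field; rewrite gt_eqF// sinh_gt0// mulr_gt0.
apply/le_anti/andP; split; last exact: calibration_le_cost.
have -> : S t x - S 0 0 = S t (f t *: x) - S 0 (f 0 *: x).
  by rewrite ft f0 scale1r scale0r.
rewrite -action_extremal; apply: ereal_inf_lbound.
exists (fun u => f u *: x) => //; split; last 2 first.
- by rewrite f0 scale0r.
- by rewrite ft scale1r.
(* The extremal is smooth on the whole line, so a single piece suffices. *)
exists [:: t]; first exact: itv_partition1.
by case=> // _; exists (fun u => f u *: x).
Qed.

End OscillatorCost.

(** * Matching the cost with the explicit kernel *)

Theorem theorem3p4 (R : realType) (n : nat) (k : R) (hk : 0 < k) :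
  let U1 := fun y : 'rV[R]_n => - (k / 2) * sqnorm y in
  let U2 := fun _ : 'rV[R]_n => 0 : R in
  let V := fun y : 'rV[R]_n =>
    laplacian U1 y + 2^-1 * sqnorm (grad U1 y) - 2 * U2 y in
  (forall y : 'rV[R]_n, V y = - k * n%:R + 2^-1 * k ^+ 2 * sqnorm y) /\
  (forall (t : R) (x : 'rV[R]_n), 0 < t ->
    ((rho k t x)%:E =
     expeR ((- 2^-1)%:E * (cost V 0 t 0 x + (U1 x)%:E - (U1 0)%:E))
     * ((4 * pi * b_neg k t) `^ (- (n%:R / 2)))%:E)%E).
Proof.
move=> U1 U2 V.
have VE y : V y = - k * n%:R + 2^-1 * k ^+ 2 * sqnorm y.
  by rewrite /V /U1 /U2 laplacian_sqnorm grad_sqnorm sqnormZ; field.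
split=> // t x t0.
rewrite (funext VE) oscillator_cost//.
rewrite /U1 sqnorm0 mulr0 -!(EFinD,EFinN,EFinM) /=; congr EFin.
(* Both sides are now expressed rationally through [E], that is exp(kt). *)
set E := expR (k * t).
have E1 : 1 < E by rewrite -expR0 ltr_expR mulr_gt0.
have E0 : 0 < E by exact: expR_gt0.
have Esq : expR (2 * t * k) = E ^+ 2.
  by rewrite /E -expRM_natl; congr expR; ring.
have Es1 : 0 < E ^+ 2 - 1 by rewrite subr_gt0 exprn_egt1.
have shE : sinh (k * t) = (E ^+ 2 - 1) / (2 * E).
  by rewrite /sinh expRN -/E; field; rewrite gt_eqF.
have chE : cosh (k * t) = (E ^+ 2 + 1) / (2 * E).
  by rewrite /cosh expRN -/E; field; rewrite gt_eqF.
(* The surplus factor [E^-1], raised to the power -n/2, gives exp(nkt/2). This is what the constant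
   -kn of [V] contributes: it adds -knt to the cost, which is then multiplied by -1/2. *)
have pref : 2 * pi * (E ^+ 2 - 1) / (k * E ^+ 2) = 4 * pi * b_neg k t * E^-1.
  by rewrite /b_neg shE; field; rewrite !gt_eqF.
rewrite /rho Esq pref powRM; last 2 first.
- apply: mulr_ge0; first by rewrite mulr_ge0// pi_ge0.
  by rewrite /b_neg mulr_ge0 ?invr_ge0 ?(ltW hk)// ltW// sinh_gt0// mulr_gt0.
- by rewrite invr_ge0 ltW.
rewrite -mulrA mulrC; congr (_ * _).
rewrite -expRN /powR gt_eqF ?expR_gt0// expRK -expRD; congr expR.
(* For the terms in [sqnorm x], the identity is coth(kt) - 1 = 2 / (exp(2kt) - 1), the -1 coming
   from [U1 x]. *)
rewrite shE chE; field.
by rewrite !gt_eqF.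
Qed.
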